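(* If $F\in\mathscr{G}$, then there exists a constant $C$ such that $$|F(\mathscr{B}_1)-F(\mathscr{B}_2)|\le C\,\mathrm{d}_\infty(\mathscr{B}_1,\mathscr{B}_2)$$ for every pair of barcodes $\mathscr{B}_1$ and $\mathscr{B}_2$, where $\mathrm{d}_\infty$ is the bottleneck distance.
   Context: Barcodes: an interval is encoded as $(x,d)$, with left endpoint $x\ge0$ and length $d\ge0$. $B_n$ is the orbit space of $([0,\infty)\times[0,\infty))^n$ under the action of $S_n$ permuting the $n$ pairs. The barcode space is $B=\coprod_nB_n/_\sim$, where $\sim$ is generated by $\{(x_1,d_1),\dots,(x_n,d_n)\}\sim\{(x_1,d_1),\dots,(x_{n-1},d_{n-1})\}$ whenever $d_n=0$. Bottleneck distance: for intervals put $\mathrm{d}_\infty((x_1,d_1),(x_2,d_2))=\max(|x_1-x_2|,|d_1-d_2+x_1-x_2|)$, and let the distance from an interval to the set $\Delta$ of zero-length intervals be $\mathrm{d}_\infty((x,d),\Delta)=d/2$. For barcodes $\mathscr{B}_1=\{I_\alpha\}_{\alpha\in A}$, $\mathscr{B}_2=\{J_\beta\}_{\beta\in B}$ ($A,B$ finite index sets) and a bijection $\theta:A'\to B'$ with $A'\subseteq A$, $B'\subseteq B$, let $P_\infty(\theta)=\max\big(\max_{a\in A'}\mathrm{d}_\infty(I_a,J_{\theta(a)}),\max_{a\in A\setminus A'}\mathrm{d}_\infty(I_a,\Delta),\max_{b\in B\setminus B'}\mathrm{d}_\infty(J_b,\Delta)\big)$ (a maximum over an empty set is $0$). Then $\mathrm{d}_\infty(\mathscr{B}_1,\mathscr{B}_2)=\min_\theta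 P_\infty(\theta)$ over all such $\theta$. The functions $E$: for $e=((e_{1,1},e_{1,2}),\dots,(e_{n,1},e_{n,2}))$, a nonzero $n\times2$ matrix with entries in $\{0,1\}$, let $\sigma_e(y_1,d_1,\dots,y_n,d_n)=\max_{\pi\in S_n}\sum_{i=1}^n(e_{\pi(i),1}y_i+e_{\pi(i),2}d_i)$. For a positive integer $m$ put $E_{m,e}(x_1,d_1,\dots,x_n,d_n)=\sigma_e(\min(x_1,md_1),d_1,\dots,\min(x_n,md_n),d_n)$. For nonnegative integers $k,l,p$, not all zero, $E_{m,(1,0)^k(0,1)^l(1,1)^p}$ denotes the function on $B$ whose value on a barcode represented by $n\ge k+l+p$ intervals is $E_{m,e}$, with $e$ having $k$ rows $(1,0)$, $l$ rows $(0,1)$, $p$ rows $(1,1)$ and $n-k-l-p$ rows $(0,0)$; barcodes with fewer intervals are first padded with zero-length intervals $(0,0)$. $\mathscr{G}$ is the set of functions on $B$ obtained from the functions $E_{m,(1,0)^k(0,1)^l(1,1)^p}$ by finitely many operations of taking maxima, adding and subtracting. *)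

(* Defs.v *)
From HB Require Import structures.
From mathcomp Require Import all_boot all_order all_algebra all_fingroup.
From mathcomp Require Import generic_quotient boolp reals lra zify.

Set Implicit Arguments.
Unset Strict Implicit.
Unset Printing Implicit Defensive.

Import Order.TTheory GRing.Theory Num.Theory.
Local Open Scope ring_scope.
Local Open Scope quotient_scope.

Section Barcodes.
Variable R : realType.

(* A bar (x, d) has left endpoint x and length d: d is not the right endpoint. *)
Definition bar := {I : R * R | (0 <= I.1) && (0 <= I.2)}.

Definition left_end (I : bar) : R := (val I).1.
Definition ilength (I : bar) : R := (val I).2.

Fact bar0_subproof : let I : R * R := (0, 0) in (0 <= I.1) && (0 <= I.2).
Proof. by rewrite /= lexx. Qed.

Definition bar0 : bar := exist _ (0, 0) bar0_subproof.

(* [seq bar] is the disjoint union over n of ([0,oo) x [0,oo))^n; the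
   constructor [same_perm] accounts for the passage to S_n-orbits and
   [same_drop] for the removal of a zero-length interval. *)
Inductive same_barcode : seq bar -> seq bar -> Prop :=
| same_perm s t : perm_eq s t -> same_barcode s t
| same_drop s I : ilength I = 0 -> same_barcode (rcons s I) s
| same_sym s t : same_barcode s t -> same_barcode t s
| same_trans s t u : same_barcode s t -> same_barcode t u -> same_barcode s u.

Definition same_barcodeb : rel (seq bar) :=
  fun s t => `[< same_barcode s t >].

Lemma same_barcodeb_refl : reflexive same_barcodeb.
Proof. by move=> s; apply/asboolP/same_perm. Qed.

Lemma same_barcodeb_sym : symmetric same_barcodeb.
Proof. by move=> s t; apply/asboolP/asboolP; exact: same_sym. Qed.

Lemma same_barcodeb_trans : transitive same_barcodeb.
Proof. by move=> t s u /asboolP st /asboolP tu; apply/asboolP/(same_trans st). Qed.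

Canonical same_barcode_equiv :=
  EquivRel same_barcodeb same_barcodeb_refl same_barcodeb_sym
    same_barcodeb_trans.

Definition barcode := {eq_quot same_barcode_equiv}.

Lemma barcode_piP (s t : seq bar) :
  s = t %[mod barcode] <-> same_barcode s t.
Proof. by split=> [/eqmodP/asboolP|st]; last exact/eqmodP/asboolP. Qed.

Lemma same_barcode_repr (s : seq bar) :
  same_barcode (repr (\pi_(barcode) s)) s.
Proof. by apply/barcode_piP; rewrite reprK. Qed.

Definition dist_bar (I J : bar) : R :=
  Num.max `|left_end I - left_end J|
          `|ilength I - ilength J + left_end I - left_end J|.

Definition dist_diag (I : bar) : R := ilength I / 2.

Section Matchings.
Variables s t : seq bar.

(* A bijection from a subset of the indices of s onto a subset of the indices
   of t: [theta a = Some b] when a is matched with b, [theta a = None] when a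
   is outside the domain. *)
Definition matching := {ffun 'I_(size s) -> option 'I_(size t)}.

Definition is_matching (theta : matching) : bool :=
  [forall a, forall a', (theta a != None) && (theta a == theta a')
                          ==> (a == a')].

Definition cost (theta : matching) : R :=
  Num.max
    (\big[Num.max/0]_a \big[Num.max/0]_(b | theta a == Some b)
       dist_bar (tnth (in_tuple s) a) (tnth (in_tuple t) b))
    (Num.max
       (\big[Num.max/0]_(a | theta a == None) dist_diag (tnth (in_tuple s) a))
       (\big[Num.max/0]_(b | Some b \notin codom theta)
          dist_diag (tnth (in_tuple t) b))).

Definition empty_matching : matching := [ffun=> None].

(* The seed of the minimum is the cost of the empty matching, which is itself
   one of the matchings minimised over. *)
Definition bottleneck_seq : R :=
  \big[Num.min/cost empty_matching]_(theta | is_matching theta) cost theta.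

End Matchings.

Definition bottleneck (B1 B2 : barcode) : R :=
  bottleneck_seq (repr B1) (repr B2).

(* The seed of the maximum is its term at the identity permutation. *)
Definition sigma n (e : 'M[bool]_(n, 2)) (v : n.-tuple (R * R)) : R :=
  let S (pi : 'S_n) :=
    \sum_(i < n) ((e (pi i) 0)%:R * (tnth v i).1
                  + (e (pi i) 1)%:R * (tnth v i).2) in
  \big[Num.max/S 1%g]_(pi : 'S_n) S pi.

Definition clip (m : nat) (I : bar) : R * R :=
  (Num.min (left_end I) (m%:R * ilength I), ilength I).

Definition E_mat m n (e : 'M[bool]_(n, 2)) (s : n.-tuple bar) : R :=
  sigma e (map_tuple (clip m) s).

(* The n x 2 matrix (1,0)^k (0,1)^l (1,1)^p (0,0)^(n-k-l-p). *)
Definition klp_mat n (k l p : nat) : 'M[bool]_(n, 2) :=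
  \matrix_(i < n, j < 2)
    if (i < k)%N then j == 0
    else if (i < k + l)%N then j == 1
    else (i < k + l + p)%N.

Definition pad N (s : seq bar) : seq bar :=
  s ++ nseq (N - size s) bar0.

Definition E_seq m k l p (s : seq bar) : R :=
  let s' := pad (k + l + p) s in
  E_mat m (klp_mat (size s') k l p) (in_tuple s').

Definition E m k l p (B : barcode) : R := E_seq m k l p (repr B).

Inductive calG : (barcode -> R) -> Prop :=
| G_E m k l p : (0 < m)%N -> (0 < k + l + p)%N -> calG (E m k l p)
| G_max F1 F2 : calG F1 -> calG F2 -> calG (fun B => Num.max (F1 B) (F2 B))
| G_add F1 F2 : calG F1 -> calG F2 -> calG (fun B => F1 B + F2 B)
| G_sub F1 F2 : calG F1 -> calG F2 -> calG (fun B => F1 B - F2 B).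

Lemma ilength_ge0 (I : bar) : 0 <= ilength I.
Proof. by case/andP: (valP I). Qed.

Lemma left_end_ge0 (I : bar) : 0 <= left_end I.
Proof. by case/andP: (valP I). Qed.

Lemma dist_barxx (I : bar) : dist_bar I I = 0.
Proof. by rewrite /dist_bar !subrr add0r subrr normr0 maxxx. Qed.

Lemma dist_bar_triangle (I J K : bar) :
  dist_bar I K <= dist_bar I J + dist_bar J K.
Proof.
rewrite /dist_bar ge_max; apply/andP; split.
  have -> : left_end I - left_end K =
    (left_end I - left_end J) + (left_end J - left_end K) by lra.
  by rewrite (le_trans (ler_normD _ _))// lerD// le_max lexx.
have -> : ilength I - ilength K + left_end I - left_end K =
  (ilength I - ilength J + left_end I - left_end J)
  + (ilength J - ilength K + left_end J - left_end K) by lra.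
by rewrite (le_trans (ler_normD _ _))// lerD// le_max lexx orbT.
Qed.

Lemma dist_barC (I J : bar) : dist_bar I J = dist_bar J I.
Proof.
rewrite /dist_bar distrC; congr Num.max.
by rewrite -normrN; congr `|_|; lra.
Qed.

Lemma dist_diag_triangle (I J : bar) :
  dist_diag I <= dist_bar I J + dist_diag J.
Proof.
rewrite /dist_diag.
have n1 : ilength I - ilength J + left_end I - left_end J <= dist_bar I J.
  by rewrite le_max ler_norm orbT.
have n2 : - (left_end I - left_end J) <= dist_bar I J.
  by rewrite le_max -normrN ler_norm.
lra.
Qed.

Lemma dist_diag_ge0 (I : bar) : 0 <= dist_diag I.
Proof. by rewrite divr_ge0 ?ilength_ge0. Qed.

Section Cost.
Variables (s t : seq bar) (theta : matching s t).

Lemma cost_le c : 0 <= c ->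
  (forall a b, theta a = Some b ->
     dist_bar (tnth (in_tuple s) a) (tnth (in_tuple t) b) <= c) ->
  (forall a, theta a = None -> dist_diag (tnth (in_tuple s) a) <= c) ->
  (forall b, Some b \notin codom theta ->
     dist_diag (tnth (in_tuple t) b) <= c) ->
  cost theta <= c.
Proof.
move=> c0 h1 h2 h3; rewrite /cost !ge_max; apply/and3P; split.
- apply: bigmax_le => // a _; apply: bigmax_le => // b /eqP; exact: h1.
- by apply: bigmax_le => // a /eqP; exact: h2.
- by apply: bigmax_le => // b; exact: h3.
Qed.

Lemma cost_ge0 : 0 <= cost theta.
Proof. by rewrite /cost !le_max bigmax_ge_id. Qed.

Lemma cost_matched a b : theta a = Some b ->
  dist_bar (tnth (in_tuple s) a) (tnth (in_tuple t) b) <= cost theta.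
Proof.
move=> ab; rewrite /cost le_max; apply/orP; left.
apply: (bigmax_sup a) => //; apply: (bigmax_sup b) => //.
exact/eqP.
Qed.

Lemma cost_unmatched_left a : theta a = None ->
  dist_diag (tnth (in_tuple s) a) <= cost theta.
Proof.
move=> /eqP ta; rewrite /cost !le_max; apply/orP; right; apply/orP; left.
exact: (bigmax_sup a).
Qed.

Lemma cost_unmatched_right b : Some b \notin codom theta ->
  dist_diag (tnth (in_tuple t) b) <= cost theta.
Proof.
move=> tb; rewrite /cost !le_max; apply/orP; right; apply/orP; right.
exact: (bigmax_sup b).
Qed.

Lemma is_matchingP :
  reflect (forall a a' b, theta a = Some b -> theta a' = Some b -> a = a')
    (is_matching theta).
Proof.
apply: (iffP idP) => [/forallP h a a' b ta ta'|h].
  by move/forallP: (h a) => /(_ a'); rewrite ta ta' eqxx /= => /eqP.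
apply/forallP => a; apply/forallP => a'; apply/implyP => /andP[].
case ta: (theta a) => [b|] //= _ /eqP tb.
by apply/eqP/(h _ _ b).
Qed.

End Cost.

Lemma bottleneck_seq_le (s t : seq bar) (theta : matching s t) :
  is_matching theta -> bottleneck_seq s t <= cost theta.
Proof. exact: bigmin_le_cond. Qed.

(* The minimum is attained by a matching. *)
Lemma bottleneck_seqP (s t : seq bar) :
  exists2 theta : matching s t, is_matching theta &
    bottleneck_seq s t = cost theta.
Proof.
rewrite /bottleneck_seq; elim/big_ind: _.
- exists (empty_matching s t) => //.
  by apply/is_matchingP => a a' b; rewrite ffunE.
- move=> x y [th mth ->] [th' mth' ->].
  by rewrite minElt; case: ifP => _; [exists th|exists th'].
- by move=> th mth; exists th.
Qed.

Lemma bottleneck_seq_ge0 (s t : seq bar) : 0 <= bottleneck_seq s t.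
Proof. by have [th _ ->] := bottleneck_seqP s t; exact: cost_ge0. Qed.

Lemma bottleneck_seq_sym_le (s t : seq bar) :
  bottleneck_seq t s <= bottleneck_seq s t.
Proof.
have [th /is_matchingP mth ->] := bottleneck_seqP s t.
pose th' : matching t s := [ffun b => [pick a | th a == Some b]].
have th'P b a : th' b = Some a <-> th a = Some b.
  rewrite ffunE; case: pickP => [a' /eqP tha'|h]; split=> //.
  - by case=> <-.
  - by move=> tha; congr Some; exact: mth tha.
  - by move=> tha; have := h a; rewrite tha eqxx.
apply: (@le_trans _ _ (cost th')).
  apply: bottleneck_seq_le; apply/is_matchingP => b b' a /th'P ba /th'P.
  by rewrite ba => -[].
apply: cost_le; first exact: cost_ge0.
- by move=> b a /th'P ab; rewrite dist_barC; exact: cost_matched.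
- move=> b tb; apply: cost_unmatched_right; apply/negP => /codomP[a /esym].
  by move/th'P; rewrite tb.
- move=> a ta; apply: cost_unmatched_left.
  case E: (th a) => [b|] //; move/th'P: E => E.
  by move: ta; rewrite -E codom_f.
Qed.

Lemma bottleneck_seqC (s t : seq bar) :
  bottleneck_seq s t = bottleneck_seq t s.
Proof. by apply/eqP; rewrite eq_le !bottleneck_seq_sym_le. Qed.

Lemma bottleneck_seq_triangle (s t u : seq bar) :
  bottleneck_seq s u <= bottleneck_seq s t + bottleneck_seq t u.
Proof.
have [th1 /is_matchingP m1 ->] := bottleneck_seqP s t.
have [th2 /is_matchingP m2 ->] := bottleneck_seqP t u.
pose th : matching s u := [ffun a => obind th2 (th1 a)].
have thP a c : th a = Some c -> exists2 b, th1 a = Some b & th2 b = Some c.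
  by rewrite ffunE; case: (th1 a) => [b|] //= bc; exists b.
apply: (@le_trans _ _ (cost th)).
  apply: bottleneck_seq_le; apply/is_matchingP => a a' c.
  case/thP=> b ab bc /thP[b' ab' b'c].
  by rewrite (m2 _ _ _ b'c bc) in ab'; exact: m1 ab'.
have [p1 p2] := (cost_ge0 th1, cost_ge0 th2).
apply: cost_le; first exact: addr_ge0.
- move=> a c /thP[b ab bc].
  apply: (le_trans (dist_bar_triangle _ (tnth (in_tuple t) b) _)).
  by rewrite lerD// cost_matched.
- move=> a; rewrite ffunE; case ab: (th1 a) => [b|] /= tb.
    apply: (le_trans (dist_diag_triangle _ (tnth (in_tuple t) b))).
    by rewrite lerD ?cost_matched ?cost_unmatched_left.
  by rewrite -[leLHS]addr0 lerD// cost_unmatched_left.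
- move=> c nc; case: (boolP (Some c \in codom th2)) => [/codomP[b bc]|nc2].
    apply: (le_trans (dist_diag_triangle _ (tnth (in_tuple t) b))).
    rewrite addrC dist_barC lerD ?cost_matched ?cost_unmatched_right//.
    apply/negP => /codomP[a ab]; move/negP: nc; apply.
    by apply/codomP; exists a; rewrite ffunE -ab.
  by rewrite -[leLHS]add0r lerD// cost_unmatched_right.
Qed.

Lemma bottleneck_seq_same (s t : seq bar) :
  same_barcode s t -> bottleneck_seq s t = 0.
Proof.
move=> st; apply/eqP; rewrite eq_le bottleneck_seq_ge0 andbT.
elim: s t / st => [s t st|s I I0|s t _|s t u _ h1 _ h2].
- have szst := perm_size st.
  move: st; rewrite perm_sym => /(@tuple_permP _ _ t (in_tuple s))[p tE].
  have e : size s = size t by [].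
  pose th : matching s t := [ffun a => Some (cast_ord e ((p^-1)%g a))].
  apply: (@le_trans _ _ (cost th)).
    apply: bottleneck_seq_le; apply/is_matchingP => a a' b.
    rewrite !ffunE => -[<-] [H]; apply: (@perm_inj _ (p^-1)%g).
    by apply: val_inj; rewrite /= H.
  apply: cost_le => //.
  + move=> a b; rewrite ffunE => -[<-].
    suff -> : tnth (in_tuple t) (cast_ord e ((p^-1)%g a)) = tnth (in_tuple s) a.
      by rewrite dist_barxx.
    set x := tnth (in_tuple s) a.
    rewrite (tnth_nth x) /= {1}tE -[nth _ _ _](tnth_nth x _ ((p^-1)%g a)).
    by rewrite tnth_mktuple permKV.
  + by move=> a; rewrite ffunE.
  + move=> b /negP[]; apply/codomP; exists (p (cast_ord (esym e) b)).
    by rewrite ffunE permK cast_ordKV.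
- have le_s : (size s <= size (rcons s I))%N by rewrite size_rcons.
  rewrite bottleneck_seqC.
  pose th : matching s (rcons s I) := [ffun a => Some (widen_ord le_s a)].
  apply: (@le_trans _ _ (cost th)).
    apply: bottleneck_seq_le; apply/is_matchingP => a a' b.
    by rewrite !ffunE => -[<-] [H]; apply: val_inj.
  apply: cost_le => //.
  + move=> a b; rewrite ffunE => -[<-].
    by rewrite !(tnth_nth I) /= nth_rcons ltn_ord dist_barxx.
  + by move=> a; rewrite ffunE.
  + move=> b nb; rewrite (tnth_nth I) /= nth_rcons.
    case: ltnP => bs; last by rewrite if_same /dist_diag I0 mul0r.
    case/negP: nb; apply/codomP; exists (Ordinal bs).
    by rewrite ffunE; congr Some; exact: val_inj.
- by rewrite bottleneck_seqC.
- by apply: (le_trans (bottleneck_seq_triangle _ t _)); rewrite -[leRHS]addr0 lerD.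
Qed.

(* [bottleneck] does not depend on the representatives. *)
Lemma bottleneck_pi (s t : seq bar) :
  bottleneck (\pi_(barcode) s) (\pi_(barcode) t) = bottleneck_seq s t.
Proof.
rewrite /bottleneck.
have indep (s1 s2 t1 t2 : seq bar) : same_barcode s1 s2 ->
    same_barcode t1 t2 -> bottleneck_seq s1 t1 <= bottleneck_seq s2 t2.
  move=> /bottleneck_seq_same es /same_sym /bottleneck_seq_same et.
  apply: (le_trans (bottleneck_seq_triangle _ s2 _)); rewrite es add0r.
  by apply: (le_trans (bottleneck_seq_triangle _ t2 _)); rewrite et addr0.
have [rs rt] := (same_barcode_repr s, same_barcode_repr t).
by apply/eqP; rewrite eq_le !indep//; exact: same_sym.
Qed.

Section Sigma.
Variables (n : nat) (e : 'M[bool]_(n, 2)).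

Definition sigma_term (v : n.-tuple (R * R)) (pi : 'S_n) : R :=
  \sum_(i < n) ((e (pi i) 0)%:R * (tnth v i).1
                + (e (pi i) 1)%:R * (tnth v i).2).

Lemma sigma_ge (v : n.-tuple (R * R)) (pi : 'S_n) :
  sigma_term v pi <= sigma e v.
Proof. exact: le_bigmax. Qed.

Lemma sigmaP (v : n.-tuple (R * R)) :
  exists pi : 'S_n, sigma e v = sigma_term v pi.
Proof.
rewrite /sigma; elim/big_ind: _.
- by exists 1%g.
- move=> x y [p ->] [q ->].
  by rewrite maxElt; case: ifP => _; [exists q|exists p].
- by move=> p _; exists p.
Qed.

Lemma sigma_perm_le (u v : n.-tuple (R * R)) :
  perm_eq u v -> sigma e u <= sigma e v.
Proof.
move=> /tuple_permP[p uE]; have [q ->] := sigmaP u.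
have {}uE : u = [tuple tnth v (p i) | i < n] by exact: val_inj.
apply: (le_trans _ (sigma_ge v (p^-1 * q)%g)).
rewrite /sigma_term [leRHS](reindex_inj (@perm_inj _ p)) /=.
rewrite le_eqVlt; apply/orP; left; apply/eqP; apply: eq_bigr => i _.
by rewrite permM permK uE tnth_mktuple.
Qed.

Lemma sigma_perm (u v : n.-tuple (R * R)) :
  perm_eq u v -> sigma e u = sigma e v.
Proof.
by move=> uv; apply/eqP; rewrite eq_le !sigma_perm_le// perm_sym.
Qed.

End Sigma.

Definition sigma_seq k l p (v : seq (R * R)) : R :=
  sigma (klp_mat (size v) k l p) (in_tuple v).

Lemma sigma_seq_tuple k l p n (v : n.-tuple (R * R)) :
  sigma (klp_mat n k l p) v = sigma_seq k l p v.
Proof.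
case: v => v sv; have szv : size v = n by exact/eqP.
subst n; rewrite /sigma_seq /=.
by congr sigma; exact: val_inj.
Qed.

Lemma sigma_seq_perm k l p (u v : seq (R * R)) :
  perm_eq u v -> sigma_seq k l p u = sigma_seq k l p v.
Proof.
move=> uv; have su : size u == size v by rewrite (perm_size uv).
by rewrite -[u]/(val (Tuple su)) -sigma_seq_tuple; exact: sigma_perm.
Qed.

Lemma sigma_seq_rcons0 k l p (v : seq (R * R)) :
  (k + l + p <= size v)%N -> (forall x, x \in v -> (0 <= x.1) && (0 <= x.2)) ->
  sigma_seq k l p (rcons v (0, 0)) = sigma_seq k l p v.
Proof.
move=> klp v0; pose n := size v.
have sn : size (rcons v (0, 0)) == n.+1 by rewrite size_rcons.
rewrite -[rcons v _]/(val (Tuple sn)) -sigma_seq_tuple /=.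
rewrite -[v in RHS]/(val (in_tuple v)) -sigma_seq_tuple /= -/n.
set w := Tuple sn; set e := klp_mat n.+1 k l p; set e' := klp_mat n k l p.
have wmax : tnth w ord_max = (0, 0).
  by rewrite (tnth_nth (0, 0)) /= nth_rcons ltnn eqxx.
have wlift (i : 'I_n) : tnth w (lift ord_max i) = tnth (in_tuple v) i.
  by rewrite !(tnth_nth (0, 0)) /= [bump _ _](lift_max i) nth_rcons ltn_ord.
have elift (i : 'I_n) j : e (lift ord_max i) j = e' i j.
  by rewrite !mxE lift_max.
have emax j : e ord_max j = false.
  by rewrite !mxE /= !ltnNge klp (leq_trans _ klp) ?(leq_trans _ klp) //; lia.
have w0 i : (0 <= (tnth w i).1) && (0 <= (tnth w i).2).
  case: (unliftP ord_max i) => [j ->|->]; last by rewrite wmax /= lexx.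
  by rewrite wlift v0// mem_tnth.
have widen_sum (q : 'S_n) :
    sigma_term e w (lift_perm ord_max ord_max q) = sigma_term e' (in_tuple v) q.
  rewrite /sigma_term (bigD1_ord ord_max) //= wmax /= !mulr0 addr0 add0r.
  by apply: eq_bigr => i _; rewrite lift_perm_lift !elift wlift.
apply/eqP; rewrite eq_le; apply/andP; split; last first.
  by have [q ->] := sigmaP e' (in_tuple v); rewrite -widen_sum sigma_ge.
have [q ->] := sigmaP e w.
pose j := (q^-1)%g ord_max; pose r := (tperm j ord_max * q)%g.
have rmax : r ord_max = ord_max by rewrite permM tpermR permKV.
have qr : sigma_term e w q <= sigma_term e w r.
  apply: ler_sum => i _.
  have [->|ni] := eqVneq i j.
    rewrite /j permKV !emax !mul0r addr0; case/andP: (w0 j) => w1 w2.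
    by apply: addr_ge0; apply: mulr_ge0; rewrite ?ler0n.
  have [->|nm] := eqVneq i ord_max; first by rewrite wmax /= !mulr0.
  by rewrite permM tpermD // eq_sym.
apply: (le_trans qr).
have rlift i : r (lift ord_max i) != ord_max.
  by rewrite -{2}rmax (inj_eq perm_inj) eq_sym neq_lift.
pose f (i : 'I_n) : 'I_n := odflt i (unlift ord_max (r (lift ord_max i))).
have fE i : lift ord_max (f i) = r (lift ord_max i).
  rewrite /f; case: unliftP => [i' -> //|h].
  by have := rlift i; rewrite h eqxx.
have f_inj : injective f.
  move=> a b fab; apply: (@lift_inj _ ord_max); apply: (@perm_inj _ r).
  by rewrite -!fE fab.
have -> : r = lift_perm ord_max ord_max (perm f_inj).
  apply/permP => i; case: (unliftP ord_max i) => [i' ->|->].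
    by rewrite lift_perm_lift [perm f_inj _]permE fE.
  by rewrite lift_perm_id.
by rewrite widen_sum sigma_ge.
Qed.

Lemma clip_ge0 m (I : bar) : (0 <= (clip m I).1) && (0 <= (clip m I).2).
Proof. by rewrite /= le_min left_end_ge0 mulr_ge0 ?ilength_ge0. Qed.

Lemma clip_ilength0 m (I : bar) : ilength I = 0 -> clip m I = (0, 0).
Proof.
by move=> I0; rewrite /clip I0 mulr0; congr pair; apply/min_idPr/left_end_ge0.
Qed.

Lemma E_seqE m k l p (s : seq bar) :
  E_seq m k l p s = sigma_seq k l p (map (clip m) (pad (k + l + p) s)).
Proof. by rewrite /E_seq /E_mat /= sigma_seq_tuple. Qed.

Lemma E_seq_same m k l p (s t : seq bar) :
  same_barcode s t -> E_seq m k l p s = E_seq m k l p t.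
Proof.
move=> st; elim: s t / st => [s t st|s I I0|s t _ -> //|s t u _ -> _ //].
  rewrite !E_seqE; apply/sigma_seq_perm/perm_map.
  by rewrite /pad (perm_size st) perm_cat2r.
rewrite !E_seqE /pad size_rcons; have cI := clip_ilength0 m I0.
have c0 : clip m bar0 = (0, 0) by exact: clip_ilength0.
case: (ltnP (size s) (k + l + p)) => [lt|le].
  rewrite -[(k + l + p - size s)%N]prednK ?subn_gt0// -subnS /=.
  by rewrite cat_rcons !map_cat /= cI c0.
have [-> ->] : (k + l + p - size s = 0 /\ k + l + p - (size s).+1 = 0)%N by lia.
rewrite !cats0 map_rcons cI sigma_seq_rcons0 ?size_map//.
by move=> x /mapP[J _ ->]; exact: clip_ge0.
Qed.

(* [E] does not depend on the representative. *)
Lemma E_pi m k l p (s : seq bar) :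
  E m k l p (\pi_(barcode) s) = E_seq m k l p s.
Proof. exact/E_seq_same/same_barcode_repr. Qed.

End Barcodes.

(* Main.v *)
Require Import Defs.
From mathcomp Require Import all_boot all_order all_algebra.
From mathcomp Require Import all_fingroup.
From mathcomp Require Import generic_quotient reals lra zify.

(** A matching of cost [c] becomes a list of pairs of bars at distance at most
    [c] once every unmatched bar [(x, d)] is paired with the zero-length bar
    [(x + d/2, 0)], which lies at distance [d/2]; adding zero-length bars
    changes neither barcode.  Along such a list each clipped coordinate moves by
    at most [2mc], and a term of [sigma] involves at most [2(k + l + p)]
    coordinates however many bars there are, so every [E] is Lipschitz.  Maxima,
    sums and differences preserve this. *)

Import Order.TTheory GRing.Theory Num.Theory.
Local Open Scope ring_scope.

Section Lipschitz.
Variable R : realType.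
Implicit Types (s t : seq (bar R)) (I J : bar R).

Lemma same_barcode_filter s :
  same_barcode s [seq I <- s | ilength I != 0].
Proof.
elim/last_ind: s => [|s I IH]; first exact: same_perm.
rewrite filter_rcons; have [I0|_] /= := eqVneq (ilength I) 0.
  exact: same_trans (same_drop s I0) IH.
(* [same_drop] only removes a last bar, so dropping bars before [I] needs compatibility of the
   relation with [rcons]; in the drop case a permutation first moves [J] behind [I]. *)
suff rcons_congr t u : same_barcode t u ->
    same_barcode (rcons t I) (rcons u I) by exact: rcons_congr.
elim=> {s IH t u} [s t st|s J J0|s t _|s t u _ st _]; last 1 first.
- exact: same_trans st.
- by apply: same_perm; rewrite -!cats1 perm_cat2r.
- apply: same_trans (same_drop (rcons s I) J0); apply: same_perm.
  by rewrite -!cats1 -!catA perm_cat2l perm_catC.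
- exact: same_sym.
Qed.

Lemma same_barcode_of_filter s t :
  perm_eq [seq I <- s | ilength I != 0] [seq I <- t | ilength I != 0] ->
  same_barcode s t.
Proof.
move=> /same_perm st; apply: same_trans (same_barcode_filter s) _.
exact: same_trans st (same_sym (same_barcode_filter t)).
Qed.

Fact midpoint_subproof I :
  let K : R * R := (left_end I + ilength I / 2, 0) in (0 <= K.1) && (0 <= K.2).
Proof.
by rewrite /= lexx andbT addr_ge0 ?left_end_ge0 ?divr_ge0 ?ilength_ge0.
Qed.

Definition midpoint I : bar R :=
  exist _ (left_end I + ilength I / 2, 0) (midpoint_subproof I).

(** Both endpoints of a bar lie at half its length from its midpoint, so the two terms of the
    maximum coincide. *)
Lemma dist_bar_midpoint I : dist_bar I (midpoint I) = dist_diag I.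
Proof.
have d0 := dist_diag_ge0 I; rewrite /dist_bar.
have -> : left_end I - left_end (midpoint I) = - dist_diag I.
  by rewrite {2}/left_end /= /dist_diag; lra.
have -> : ilength I - ilength (midpoint I) + left_end I - left_end (midpoint I)
    = dist_diag I.
  by rewrite {2}/ilength {2}/left_end /= /dist_diag; lra.
by rewrite normrN maxxx ger0_norm.
Qed.

Lemma matching_pairs s t (theta : matching s t) : is_matching theta ->
  exists w : seq (bar R * bar R),
    [/\ same_barcode s (unzip1 w), same_barcode t (unzip2 w) &
        forall x, x \in w -> dist_bar x.1 x.2 <= cost theta].
Proof.
move=> /is_matchingP mth.
pose Is := tnth (in_tuple s); pose Js := tnth (in_tuple t).
pose g a := if theta a is Some b then Js b else midpoint (Is a).
pose free := [seq b <- enum 'I_(size t) | Some b \notin codom theta].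
(* One pair for each bar of [s], then one for each bar of [t] outside the image of [theta]. *)
exists ([seq (Is a, g a) | a <- enum 'I_(size s)]
        ++ [seq (midpoint (Js b), Js b) | b <- free]); split.
- apply: same_barcode_of_filter.
  rewrite /unzip1 map_cat -2!map_comp filter_cat.
  rewrite (_ : [seq I <- map _ free | _] = [::]); last first.
    by elim: free => //= b l ->; rewrite eqxx.
  rewrite cats0 (_ : map _ _ = s) //.
  by rewrite -[RHS]/(val (in_tuple s)) -[RHS]map_tnth_enum; apply: eq_map.
- apply: same_barcode_of_filter.
  rewrite /unzip2 map_cat -2!map_comp filter_cat /=.
  (* Midpoints have length zero, so the filter discards them and only the partners of matched bars
     can remain. *)
  rewrite (_ : [seq I <- map _ (enum _) | _] =
    [seq I <- map Js (pmap theta (enum 'I_(size s))) | ilength I != 0]);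
    last first.
    elim: (enum _) => //= a l ->; rewrite /g.
    by case: (theta a) => [b|] //=; rewrite eqxx.
  rewrite -filter_cat -[map (_ \o _) free]/(map Js free) -map_cat.
  apply: perm_filter.
  rewrite -[X in perm_eq X _](map_tnth_enum (in_tuple t)).
  (* Matched and free indices together enumerate the indices of [t] exactly once: injectivity of
     [theta] excludes repetitions among the matched ones. *)
  apply: perm_map; apply: uniq_perm; first exact: enum_uniq.
    rewrite cat_uniq filter_uniq ?enum_uniq// andbT; apply/andP; split.
      rewrite -(map_inj_uniq (@Some_inj _)) pmapS_filter.
      rewrite map_inj_in_uniq; first exact/filter_uniq/enum_uniq.
      move=> a a'; rewrite !mem_filter => /andP[].
      by case E: (theta a) => [b|] // _ _ _ /esym; exact: mth.
    apply/hasPn => b; rewrite mem_filter => /andP[nb _].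
    apply: contra nb; rewrite mem_pmap => /mapP[a _ ->].
    exact: codom_f.
  move=> b; rewrite mem_enum mem_cat mem_pmap /free.
  by rewrite [b \in filter _ _]mem_filter mem_enum andbT orbN.
- move=> x; rewrite mem_cat => /orP[] /mapP[a].
    move=> _ -> /=; rewrite /g; case E: (theta a) => [b|].
      exact: cost_matched.
    by rewrite dist_bar_midpoint; exact: cost_unmatched_left.
  rewrite mem_filter => /andP[na _] -> /=.
  by rewrite dist_barC dist_bar_midpoint; exact: cost_unmatched_right.
Qed.

(** Both endpoints move by at most [c], hence the length by at most [2 * c] and [m] times the length
    by at most [2 * m * c]; as [m] is at least 1, this also bounds the other changes. *)
Lemma clip_lipschitz m I J : (0 < m)%N ->
  (clip m I).1 - (clip m J).1 <= 2 * m%:R * dist_bar I J /\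
  (clip m I).2 - (clip m J).2 <= 2 * m%:R * dist_bar I J.
Proof.
move=> m0; rewrite /clip /=; have m1 : 1 <= m%:R :> R by rewrite ler1n.
set c := dist_bar I J.
have h1 : `|left_end I - left_end J| <= c by rewrite le_max lexx.
have h2 : `|ilength I - ilength J + left_end I - left_end J| <= c.
  by rewrite le_max lexx orbT.
have c0 : 0 <= c := le_trans (normr_ge0 _) h1.
move: h1 h2; rewrite !ler_norml => /andP[h1 h1'] /andP[h2 h2'].
have hd : ilength I - ilength J <= 2 * c by lra.
have hc : 0 <= (m%:R - 1) * c by rewrite mulr_ge0 ?subr_ge0.
split; last by lra.
have hm : 0 <= m%:R * (2 * c - (ilength I - ilength J)).
  by rewrite mulr_ge0 ?ler0n ?subr_ge0.
(* The minimum for [I] is bounded by the argument that attains the minimum for [J]. *)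
rewrite lerBlDr ge_min; apply/orP.
by case: (leP (left_end J)) => _; [left|right]; lra.
Qed.

(** A permutation optimal for the first list is a competitor for the second, so it suffices to
    compare two sums with the same permutation, row by row. *)
Lemma sigma_seq_lipschitz k l p (x : seq ((R * R) * (R * R))) (K : R) :
  0 <= K ->
  (forall y, y \in x -> y.1.1 - y.2.1 <= K /\ y.1.2 - y.2.2 <= K) ->
  sigma_seq k l p (unzip1 x) <=
    sigma_seq k l p (unzip2 x) + 2 * (k + l + p)%:R * K.
Proof.
move=> K0 hx; pose n := size x.
have s1 : size (unzip1 x) == n by rewrite size_map.
have s2 : size (unzip2 x) == n by rewrite size_map.
rewrite -[unzip1 x]/(val (Tuple s1)) -[unzip2 x]/(val (Tuple s2)).
rewrite -!sigma_seq_tuple.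
set e := klp_mat n k l p; have [q ->] := sigmaP e (Tuple s1).
apply: le_trans (lerD (sigma_ge _ _ q) (lexx _)).
have -> : 2 * (k + l + p)%:R * K =
    \sum_(i < k + l + p) (K + K).
  by rewrite sumr_const card_ord -mulr_natl; lra.
(* Only rows of index below [k + l + p] can be nonzero, which keeps the bound independent of [n]. *)
have row_bound : \sum_(i < n) ((e (q i) 0)%:R * K + (e (q i) 1)%:R * K) <=
    \sum_(i < k + l + p) (K + K).
  rewrite -(reindex_inj (@perm_inj _ q) (P := xpredT)
    (F := fun i => (e i 0)%:R * K + (e i 1)%:R * K)) /=.
  apply: (@le_trans _ _ (\sum_(i < n | (i < k + l + p)%N) (K + K))).
    rewrite [leRHS]big_mkcond; apply: ler_sum => i _.
    have [_|i_ge] := ltnP i (k + l + p).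
      by apply: lerD; apply: ler_piMl; rewrite // lern1 leq_b1.
    rewrite !mxE !ltnNge i_ge (leq_trans _ i_ge) ?(leq_trans _ i_ge); try lia.
    by rewrite !mul0r addr0.
  have [h|/ltnW h] := leqP (k + l + p) n; first by rewrite (big_ord_narrow h).
  rewrite !sumr_const card_ord; apply: ler_wpMn2l; first exact: addr_ge0.
  by rewrite (leq_trans (max_card _))// card_ord.
apply: le_trans (lerD (lexx _) row_bound).
rewrite /sigma_term -big_split /=; apply: ler_sum => i _.
have z0 := ((0, 0), (0, 0)) : (R * R) * (R * R).
have -> : tnth (Tuple s1) i = (nth z0 x i).1.
  by rewrite (tnth_nth z0.1) /= (nth_map z0).
have -> : tnth (Tuple s2) i = (nth z0 x i).2.
  by rewrite (tnth_nth z0.2) /= (nth_map z0).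
have [h1 h2] := hx _ (mem_nth z0 (ltn_ord i)).
by case: (e _ 0); case: (e _ 1); rewrite ?mul1r ?mul0r; lra.
Qed.

Lemma E_seq_pairs m k l p (w : seq (bar R * bar R)) (c : R) :
  (0 < m)%N -> 0 <= c -> (forall x, x \in w -> dist_bar x.1 x.2 <= c) ->
  E_seq m k l p (unzip1 w) <=
    E_seq m k l p (unzip2 w) + 2 * (k + l + p)%:R * (2 * m%:R * c).
Proof.
move=> m0 c0 hw; rewrite !E_seqE /pad !size_map.
(* Both lists have the length of [w] and receive equally many padding bars, which pair up at
   distance 0. *)
pose w' := w ++ nseq (k + l + p - size w) (bar0 R, bar0 R).
pose x := [seq (clip m y.1, clip m y.2) | y <- w'].
have -> : map (clip m) (unzip1 w ++ nseq (k + l + p - size w) (bar0 R)) =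
    unzip1 x.
  by rewrite /x /w' /unzip1 -map_comp !map_cat -map_comp !map_nseq.
have -> : map (clip m) (unzip2 w ++ nseq (k + l + p - size w) (bar0 R)) =
    unzip2 x.
  by rewrite /x /w' /unzip2 -map_comp !map_cat -map_comp !map_nseq.
have m2 : 0 <= 2 * m%:R :> R by rewrite mulr_ge0 ?ler0n.
apply: sigma_seq_lipschitz; first exact: mulr_ge0.
move=> _ /mapP[y yw ->] /=.
have yc : dist_bar y.1 y.2 <= c.
  move: yw; rewrite mem_cat => /orP[/hw//|/nseqP[-> _]].
  by rewrite dist_barxx.
have [h1 h2] := @clip_lipschitz m y.1 y.2 m0.
have /(ler_wpM2l m2) h := yc.
by split; [apply: le_trans h1 h|apply: le_trans h2 h].
Qed.

Lemma bottleneck_ge0 (B1 B2 : barcode R) : 0 <= bottleneck B1 B2.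
Proof. exact: bottleneck_seq_ge0. Qed.

Lemma bottleneckC (B1 B2 : barcode R) : bottleneck B1 B2 = bottleneck B2 B1.
Proof. exact: bottleneck_seqC. Qed.

Lemma E_lipschitz m k l p (B1 B2 : barcode R) : (0 < m)%N ->
  `|E m k l p B1 - E m k l p B2| <=
    2 * (k + l + p)%:R * (2 * m%:R) * bottleneck B1 B2.
Proof.
move=> m0; suff one_sided (A1 A2 : barcode R) : E m k l p A1 <=
    E m k l p A2 + 2 * (k + l + p)%:R * (2 * m%:R) * bottleneck A1 A2.
  have h1 := one_sided B1 B2; have := one_sided B2 B1.
  by rewrite bottleneckC => h2; rewrite ler_norml; apply/andP; split; lra.
rewrite /E /bottleneck; have [th mth ->] := bottleneck_seqP (repr A1) (repr A2).
have [w [w1 w2 hw]] := matching_pairs _ _ _ mth.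
(* Invariance of [E_seq] replaces the representatives by the two paired lists, while the bound stays
   the cost of [th]. *)
rewrite (E_seq_same _ _ _ _ w1) (E_seq_same _ _ _ _ w2) -mulrA.
exact: E_seq_pairs m0 (cost_ge0 th) hw.
Qed.

End Lipschitz.

Lemma dist_max_le (R : realDomainType) (a b a' b' : R) :
  `|Num.max a b - Num.max a' b'| <= `|a - a'| + `|b - b'|.
Proof.
have [h1 h2] := (ler_norm (a - a'), ler_norm (b - b')).
have [] := (ler_norm (a' - a), ler_norm (b' - b)).
rewrite [`|a' - a|]distrC [`|b' - b|]distrC => h3 h4.
rewrite ler_norml; apply/andP; split;
  by case: (leP a b); case: (leP a' b') => ? ?; lra.
Qed.

Theorem theorem7p1 (R : realType) (F : barcode R -> R) :
  calG F ->
  exists C : R, forall B1 B2 : barcode R,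
    `|F B1 - F B2| <= C * bottleneck B1 B2.
Proof.
elim=> {F} [m k l p m0 _|F1 F2 _ [C1 h1] _ [C2 h2]|F1 F2 _ [C1 h1] _ [C2 h2]
  |F1 F2 _ [C1 h1] _ [C2 h2]].
- by exists (2 * (k + l + p)%:R * (2 * m%:R)) => B1 B2; exact: E_lipschitz.
(* Under each of the three operations the constants add. *)
- exists (C1 + C2) => B1 B2; rewrite mulrDl.
  exact: le_trans (dist_max_le _ _ _ _ _) (lerD (h1 _ _) (h2 _ _)).
- exists (C1 + C2) => B1 B2; rewrite mulrDl opprD addrACA.
  exact: le_trans (ler_normD _ _) (lerD (h1 _ _) (h2 _ _)).
- exists (C1 + C2) => B1 B2; rewrite mulrDl.
  have -> : F1 B1 - F2 B1 - (F1 B2 - F2 B2) =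
    (F1 B1 - F1 B2) - (F2 B1 - F2 B2) by lra.
  exact: le_trans (ler_normB _ _) (lerD (h1 _ _) (h2 _ _)).
Qed.
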